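(* Let $R$ be a finite ring, not necessarily commutative, and let $\Bbbk$ be a left Noetherian ring. Then the categories of $\mathrm{V}(R)$-modules, of $\mathrm{VI}(R)$-modules and of $\mathrm{VIC}(R)$-modules over $\Bbbk$ are all locally Noetherian.
   Context: Modules $R^n$ are column vectors, regarded as right $R$-modules. For $n\ge 0$ write $[R^n]$ for $R^n$ regarded as an object of a category. The category $\mathrm{V}(R)$ has objects $[R^n]$, $n\ge 0$, and morphisms $[R^n]\to[R^m]$ all $R$-linear maps $R^n\to R^m$. The category $\mathrm{VI}(R)$ has the same objects, and morphisms $[R^n]\to[R^m]$ the injective $R$-linear maps $f\colon R^n\to R^m$ for which there exists an $R$-linear $g\colon R^m\to R^n$ with $g\circ f=\mathrm{id}$. The category $\mathrm{VIC}(R)$ has the same objects; a morphism $[R^n]\to[R^m]$ is a pair $(f',f'')$ with $f'\colon R^n\to R^m$ an injective $R$-linear map and $f''\colon R^m\to R^n$ an $R$-linear map with $f''\circ f'=\mathrm{id}$; composition is $(g',g'')\circ(f',f'')=(g'\circ f',\,f''\circ g'')$. For a category $\mathcal C$ and a ring $\Bbbk$, a $\mathcal C$-module over $\Bbbk$ is a functor from $\mathcal C$ to the category of $\Bbbk$-modules; these form an abelian category with natural transformations as morphisms. A $\mathcal C$-module $M$ is finitely generated if there are finitely many objects $c_1,\dots,c_k$ and elements $x_i\in M(c_i)$ such that the smallest $\mathcal C$-submodule of $M$ containing all $x_i$ is $M$. The category of $\mathcal C$-modules over $\Bbbk$ is locally Noetherian if every submodule of every finitely generated $\mathcal C$-module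 over $\Bbbk$ is finitely generated. *)

(* Defs.v *)
From mathcomp Require Import all_boot all_order all_algebra.
Set Implicit Arguments. Unset Strict Implicit. Unset Printing Implicit Defensive.
Import GRing.Theory.
Local Open Scope ring_scope.

(* A (small) category whose objects are the natural numbers n, standing for [R^n]. *)
Record natCat := NatCat {
  hom : nat -> nat -> Type;
  idc : forall n, hom n n;
  compc : forall n m p, hom m p -> hom n m -> hom n p
}.

Record cmod (C : natCat) (k : pzRingType) := CMod {
  cobj : nat -> lmodType k;
  cact : forall n m, hom C n m -> cobj n -> cobj m;
  cact_linear : forall n m (f : hom C n m) (a : k) (x y : cobj n),
      cact f (a *: x + y) = a *: cact f x + cact f y;
  cact_id : forall n (x : cobj n), cact (idc C n) x = x;
  cact_comp : forall n m p (g : hom C m p) (f : hom C n m) (x : cobj n),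
      cact (compc g f) x = cact g (cact f x)
}.
Arguments cobj {C k}.
Arguments cact {C k} c {n m}.

Record csubmod (C : natCat) (k : pzRingType) (M : cmod C k) := CSub {
  csub : forall n, cobj M n -> Prop;
  csub0 : forall n, csub (0 : cobj M n);
  csubD : forall n (x y : cobj M n), csub x -> csub y -> csub (x + y);
  csubZ : forall n (a : k) (x : cobj M n), csub x -> csub (a *: x);
  csub_act : forall n m (f : hom C n m) (x : cobj M n), csub x -> csub (cact M f x)
}.
Arguments csub {C k M} c {n}.

Definition in_generated (C : natCat) (k : pzRingType) (M : cmod C k)
    (gens : seq {n : nat & cobj M n}) n (v : cobj M n) : Prop :=
  forall S : csubmod M,
    (forall i, (i < size gens)%N ->
       forall d : {n : nat & cobj M n}, csub S (projT2 (nth d gens i))) ->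
    csub S v.

Definition fg_csubmod (C : natCat) (k : pzRingType) (M : cmod C k)
    (S : csubmod M) : Prop :=
  exists gens : seq {n : nat & cobj M n},
    (forall i, (i < size gens)%N ->
       forall d : {n : nat & cobj M n}, csub S (projT2 (nth d gens i))) /\
    (forall n (v : cobj M n), csub S v <-> in_generated gens v).

Definition fg_cmod (C : natCat) (k : pzRingType) (M : cmod C k) : Prop :=
  exists gens : seq {n : nat & cobj M n},
    forall n (v : cobj M n), in_generated gens v.

Definition locally_noetherian (C : natCat) (k : pzRingType) : Prop :=
  forall M : cmod C k, fg_cmod M -> forall S : csubmod M, fg_csubmod S.

Definition left_ideal (k : pzRingType) (I : k -> Prop) : Prop :=
  [/\ I 0, (forall x y, I x -> I y -> I (x + y)) & (forall a x, I x -> I (a * x))].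

Definition fg_left_ideal (k : pzRingType) (I : k -> Prop) : Prop :=
  exists s : seq k, (forall x, x \in s -> I x) /\
    forall x, I x <-> (forall J, left_ideal J -> (forall y, y \in s -> J y) -> J x).

Definition left_noetherian (k : pzRingType) : Prop :=
  forall I : k -> Prop, left_ideal I -> fg_left_ideal I.

(* The categories V(R), VI(R), VIC(R).  A right-R-linear map R^n -> R^m of
   column vectors is left multiplication by an m x n matrix. *)
Definition V_cat (R : finPzRingType) : natCat :=
  @NatCat (fun n m => 'M[R]_(m, n)) (fun n => 1%:M) (fun n m p g f => g *m f).

Definition VI_hom (R : finPzRingType) n m :=
  {A : 'M[R]_(m, n) | exists B : 'M[R]_(n, m), B *m A = 1%:M}.

Lemma VI_comp_proof (R : finPzRingType) n m p (g : VI_hom R m p) (f : VI_hom R n m) :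
  exists B : 'M[R]_(n, p), B *m (proj1_sig g *m proj1_sig f) = 1%:M.
Proof.
case: g => [A [B HB]]; case: f => [A' [B' HB']] /=.
exists (B' *m B); by rewrite mulmxA -(mulmxA B') HB mulmx1 HB'.
Qed.

Definition VI_cat (R : finPzRingType) : natCat :=
  @NatCat (VI_hom R)
    (fun n => exist _ 1%:M (ex_intro _ 1%:M (mulmx1 1%:M)))
    (fun n m p g f => exist _ (proj1_sig g *m proj1_sig f) (VI_comp_proof g f)).

(* VIC: pairs (f', f'') with f'' o f' = id; f' injective follows. *)
Definition VIC_hom (R : finPzRingType) n m :=
  {p : 'M[R]_(m, n) * 'M[R]_(n, m) | p.2 *m p.1 = 1%:M}.

Lemma VIC_comp_proof (R : finPzRingType) n m p (g : VIC_hom R m p) (f : VIC_hom R n m) :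
  ((proj1_sig f).2 *m (proj1_sig g).2) *m ((proj1_sig g).1 *m (proj1_sig f).1) = 1%:M.
Proof.
case: g => [[A B] HB]; case: f => [[A' B'] HB'] /=; simpl in *.
by rewrite mulmxA -(mulmxA B') HB mulmx1 HB'.
Qed.

Definition VIC_cat (R : finPzRingType) : natCat :=
  @NatCat (VIC_hom R)
    (fun n => exist _ (1%:M, 1%:M) (mulmx1 1%:M))
    (fun n m p g f => exist _ ((proj1_sig g).1 *m (proj1_sig f).1,
                               (proj1_sig f).2 *m (proj1_sig g).2) (VIC_comp_proof g f)).

(* Main.v *)
(* Everything is deduced from VIC(R), by a Groebner-basis argument. A morphism
   (A, B) : [R^n] -> [R^m] is read as the word whose letters are the pairs
   (column t of B, row t of A) over a finite alphabet. Call t a pivot if it is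
   the first occurrence of its column; there are at most |R|^n pivots, and for
   each column b the sum s_b of the rows of A over the occurrences of b
   satisfies sum_b b s_b = 1. A copy of an earlier non-pivot letter (b, a) can be
   inserted into the word by a VIC-morphism which leaves all the s_b unchanged:
   it duplicates that column of B and that row of A, and subtracts a from the
   row at the pivot of b. These insertions are monotone for the
   lexicographic order on words in which each pivot row is replaced by s_b, and
   by Higman's lemma the corresponding divisibility order on words is a
   well-quasi-order. Comparing ideals of leading coefficients then bounds the
   generators of a submodule.

   VI(R) is a quotient of VIC(R), and any matrix factors as a split injection
   after the matrix of its distinct rows, of which there are finitely many; so
   both V(R) and VI(R) inherit Noetherianity from VIC(R). *)
Require Import Defs.
From mathcomp Require Import all_boot all_order all_algebra.
From Stdlib Require Import Classical IndefiniteDescription.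
Set Implicit Arguments. Unset Strict Implicit. Unset Printing Implicit Defensive.
(* [Defs.hom] is otherwise hidden by the [hom] of vector spaces. *)
Import Defs GRing.Theory.
Local Open Scope ring_scope.

(** * Well-quasi-orders and Higman's lemma *)

Definition increasing (phi : nat -> nat) := {homo phi : i j / (i < j)%N}.

Lemma increasing_enumeration (P : nat -> Prop) :
    (forall N, exists n, (N <= n)%N /\ P n) ->
  exists2 phi, increasing phi & forall i, P (phi i).
Proof.
move=> /(functional_choice _)[nx nxP].
pose phi := fix phi i := if i is j.+1 then nx (phi j).+1 else nx 0%N.
exists phi; last by case=> [|i] /=; [case: (nxP 0%N) | case: (nxP (phi i).+1)].
apply: (homo_ltn ltn_trans).
by move=> i /=; case: (nxP (phi i).+1).
Qed.

Lemma constant_subsequence (F : finType) (c : nat -> F) :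
  exists a, exists2 phi, increasing phi & forall i, c (phi i) = a.
Proof.
apply: NNPP => noa.
have /fin_all_exists[N NP] a : exists N, forall n, (N <= n)%N -> c n <> a.
  apply: NNPP => noN; apply: noa; exists a; apply: (@increasing_enumeration (fun n => c n = a)) => N.
  apply: NNPP => non; apply: noN; exists N => n len cn.
  by apply: non; exists n.
pose n := \max_a N a.
exact: NP (c n) n (leq_bigmax _) erefl.
Qed.

(** Only finitely many terms lie below no later term, since infinitely many would form a subsequence
    contradicting the hypothesis. Past them, one climbs forever. *)
Lemma wqo_chain (T : Type) (le : T -> T -> Prop) :
    (forall x y z, le x y -> le y z -> le x z) ->
    (forall z : nat -> T, exists i j, (i < j)%N /\ le (z i) (z j)) ->
  forall z : nat -> T, exists2 phi, increasing phi &
    forall i j, (i < j)%N -> le (z (phi i)) (z (phi j)).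
Proof.
move=> le_trans wqo z.
have [N NP] : exists N, forall n, (N <= n)%N ->
    exists j, (n < j)%N /\ le (z n) (z j).
  apply: NNPP => noN.
  case: (@increasing_enumeration (fun n => forall j, (n < j)%N -> ~ le (z n) (z j))).
    move=> N; apply: NNPP => non; apply: noN; exists N => n len.
    apply: NNPP => noj; apply: non; exists n; split=> // j ltj lej.
    by apply: noj; exists j.
  move=> phi phi_inc term; have [i [j [ltij leij]]] := wqo (z \o phi).
  exact: term (phi_inc _ _ ltij) leij.
have /functional_choice[nx nxP] n :
    exists j, (N <= n)%N -> (n < j)%N /\ le (z n) (z j).
  case: (leqP N n) => [/NP[j jP]|_]; first by exists j.
  by exists 0%N.
pose phi i := iter i nx N.
have phi_ge i : (N <= phi i)%N.
  by elim: i => //= i IHi; apply: leq_trans IHi (ltnW (nxP _ IHi).1).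
exists phi.
  by apply: (homo_ltn ltn_trans) => i; apply: (nxP _ (phi_ge i)).1.
move=> i j; elim: j => // j IHj; rewrite ltnS leq_eqVlt => /orP[/eqP->|/IHj].
  exact: (nxP _ (phi_ge j)).2.
by move/le_trans; apply; apply: (nxP _ (phi_ge j)).2.
Qed.

Definition bad (T : eqType) (z : nat -> seq T) :=
  forall i j, (i < j)%N -> ~ subseq (z i) (z j).

(** Greedy choice after Nash-Williams: each term is a shortest word that keeps the prefix extendable
    to a bad sequence. *)
Lemma minimal_bad_sequence (T : eqType) (z : nat -> seq T) : bad z ->
  exists2 W : nat -> seq T, bad W & forall n (g : nat -> seq T), bad g ->
    (forall i, (i < n)%N -> g i = W i) -> (size (W n) <= size (g n))%N.
Proof.
move=> bad_z.
pose ext (l : seq (seq T)) := exists2 g : nat -> seq T, bad g & mkseq g (size l) = l.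
have /functional_choice[nx nxP] l : exists w, ext l -> ext (rcons l w) /\
    forall w', ext (rcons l w') -> (size w <= size w')%N.
  case: (classic (ext l)) => [[g bad_g gl]|]; last by exists [::].
  have ext_g : ext (rcons l (g (size l))).
    by exists g; rewrite // size_rcons mkseqS gl.
  elim/ltn_ind: {g bad_g gl}(size _) {-2}(g _) (erefl (size (g (size l)))) ext_g
    => s IHs w sz_w ext_w.
  case: (classic (exists2 w', ext (rcons l w') & (size w' < s)%N)).
    by case=> w' ext_w' lt_w'; apply: (IHs _ lt_w' w').
  move=> nosmall; exists w => _; split=> // w' ext_w'.
  by rewrite leqNgt sz_w; apply/negP => lt_w'; apply: nosmall; exists w'.
pose L := fix L n := if n is n'.+1 then rcons (L n') (nx (L n')) else [::].
pose W n := nx (L n).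
have LE n : L n = mkseq W n by elim: n => // n IHn; rewrite mkseqS -IHn.
have extL n : ext (L n).
  by elim: n => [|n /nxP[]//]; exists z.
exists W => [i j lt_ij|n g bad_g eq_g].
  have [g bad_g] := extL j.+1; rewrite LE size_mkseq => gW.
  have gWE k : (k <= j)%N -> g k = W k.
    by move=> le_kj; rewrite -(nth_mkseq [::] g (_ : (k < j.+1)%N)) // gW nth_mkseq.
  by rewrite -!gWE // 1?ltnW //; apply: bad_g.
apply: (nxP _ (extL n)).2; exists g => //.
rewrite size_rcons LE size_mkseq mkseqS; congr rcons.
by apply/eq_in_map => i; rewrite mem_iota => /eq_g.
Qed.

(** Along some [phi] the words of a minimal bad sequence share their first letter. Deleting it
    there, after the unchanged terms before [phi 0], gives a bad sequence with a shorter word at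
    [phi 0]. *)
Lemma higman (T : finType) (z : nat -> seq T) :
  exists i j, (i < j)%N /\ subseq (z i) (z j).
Proof.
apply: NNPP => no_good.
have [i j lt_ij le_ij|W bad_W minW] := @minimal_bad_sequence T z.
  by apply: no_good; exists i, j.
have Wcons n : exists x, W n = x.1 :: x.2.
  case En: (W n) => [|a t]; last by exists (a, t).
  by case: (bad_W n n.+1) => //; rewrite En sub0seq.
have {Wcons}[x Wx] := functional_choice _ Wcons.
have [a [phi phi_inc aE]] := constant_subsequence (fun n => (x n).1).
have {}Wx i : W (phi i) = a :: (x (phi i)).2 by rewrite -(aE i) -Wx.
pose t i := (x (phi i)).2.
pose g i := if (i < phi 0)%N then W i else t (i - phi 0)%N.
suff bad_g : bad g.
  have := minW (phi 0%N) g bad_g; rewrite Wx /g ltnn subnn ltnn.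
  by move=> contra; apply/notF/contra => i ->.
move=> i j lt_ij; rewrite /g; case: ltnP => lt_i; case: ltnP => lt_j.
- exact: bad_W.
- move=> le_ij; set k := (j - phi 0)%N in le_ij.
  apply: (bad_W i (phi k)); last first.
    by rewrite Wx; apply: subseq_trans le_ij (subseq_cons _ _).
  apply: leq_trans lt_i _; case: k {le_ij} => // k.
  exact/ltnW/phi_inc.
- by rewrite ltnNge (ltnW (leq_ltn_trans lt_i lt_ij)) in lt_j.
move=> le_ij; apply: (bad_W (phi (i - phi 0)%N) (phi (j - phi 0)%N)).
  by apply: phi_inc; rewrite ltn_sub2r // (leq_ltn_trans lt_i).
by rewrite !Wx /= eqxx.
Qed.

Lemma coloured_higman_chain (F T : finType) (c : nat -> F) (z : nat -> seq T) :
  exists2 phi, increasing phi & forall i j, (i < j)%N ->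
    c (phi i) = c (phi j) /\ subseq (z (phi i)) (z (phi j)).
Proof.
pose le (x y : F * seq T) := x.1 = y.1 /\ subseq x.2 y.2.
apply: (@wqo_chain _ le _ _ (fun i => (c i, z i))).
  move=> x1 x2 x3 [eq12 le12] [eq23 le23]; split; first by rewrite eq12.
  exact: subseq_trans le12 le23.
move=> {c z} z; have [a [phi phi_inc aE]] := constant_subsequence (fun n => (z n).1).
have [i [j [lt_ij le_ij]]] := higman (fun n => (z (phi n)).2).
by exists (phi i), (phi j); split; [exact: phi_inc | split; rewrite ?aE].
Qed.

(** * Submodules and leading coefficients *)

Lemma List_In_nth (T : Type) (P : T -> Prop) (s : seq T) :
  (forall i, (i < size s)%N -> forall d, P (nth d s i)) <->
  (forall x, List.In x s -> P x).
Proof.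
elim: s => [|y s IHs]; first by split.
split=> [Pnth x /= [<-|x_s]|PIn [|i] lti d /=].
- exact: (Pnth 0%N isT y).
- by move: x x_s; apply/IHs => i lti; apply: (Pnth i.+1).
- by apply: PIn; left.
by move: i lti d; apply/IHs => x x_s; apply: PIn; right.
Qed.

(** The pairs stand for monomials with leading coefficients. Without a finite [F] there is a
    sequence of pairs none of which is covered by its predecessors; along a [dv]-chain the left
    ideal of coefficients is generated by finitely many of them, which cover the next one. *)
Lemma left_ideal_finite_leading (k : pzRingType) (T : Type)
    (dv : T -> T -> Prop) (P : T * k -> Prop) : left_noetherian k ->
    (forall z : nat -> T, exists2 phi, increasing phi &
      forall i j, (i < j)%N -> dv (z (phi i)) (z (phi j))) ->
  exists2 F : seq (T * k), forall x, List.In x F -> P x &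
    forall y, P y -> forall J, left_ideal J ->
      (forall x, List.In x F -> dv x.1 y.1 -> J x.2) -> J y.2.
Proof.
move=> noeth chain.
pose covered F (y : T * k) := forall J, left_ideal J ->
  (forall x : T * k, List.In x F -> dv x.1 y.1 -> J x.2) -> J y.2.
apply: NNPP => noF.
have next F : (forall x, List.In x F -> P x) -> exists y, P y /\ ~ covered F y.
  move=> FP; apply: NNPP => noy; apply: noF; exists F => // y Py.
  by apply: NNPP => uncov; apply: noy; exists y.
(* [y0] is only the default value of the choice on lists not contained in [P]. *)
have [y0 _] := next [::] (fun _ => False_ind _).
have /functional_choice[nx nxP] F :
    exists y, (forall x, List.In x F -> P x) -> P y /\ ~ covered F y.
  case: (classic (forall x, List.In x F -> P x)) => [/next[y]|]; first by exists y.
  by exists y0.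
pose L := fix L n := if n is n'.+1 then nx (L n') :: L n' else [::].
pose z n := nx (L n).
have LP n : forall x, List.In x (L n) -> P x.
  by elim: n => //= n IHn x [<-|]; [exact: (nxP _ IHn).1 | exact: IHn].
have zL i n : (i < n)%N -> List.In (z i) (L n).
  elim: n => //= n IHn; rewrite ltnS leq_eqVlt => /orP[/eqP->|lti].
    by left.
  by right; apply: IHn.
have [phi phi_inc dv_phi] := chain (fun n => (z n).1).
(* The union of the left ideals generated by the first [N] coefficients along the chain. *)
pose I c := exists N, forall J, left_ideal J ->
  (forall i, (i < N)%N -> J (z (phi i)).2) -> J c.
have idI : left_ideal I.
  split=> [|x y [N xN] [N' yN]|a x [N xN]].
  - by exists 0%N => J [].
  - exists (maxn N N') => J idJ zJ; have [_ JD _] := idJ.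
    apply: JD; first by apply: xN => // i lti; apply: zJ; rewrite leq_max lti.
    by apply: yN => // i lti; apply: zJ; rewrite leq_max lti orbT.
  - by exists N => J idJ zJ; have [_ _ JM] := idJ; apply: JM; apply: xN.
have [s [sI Is]] := noeth I idI.
have [N sN] : exists N, forall y, y \in s -> forall J, left_ideal J ->
    (forall i, (i < N)%N -> J (z (phi i)).2) -> J y.
  elim: (s) sI => [|x s' IHs] sI; first by exists 0%N.
  have [y ys|N sN] := IHs; first by apply: sI; rewrite inE ys orbT.
  have [N' xN] := sI x (mem_head _ _).
  exists (maxn N N') => y; rewrite inE => /orP[/eqP->|ys] J idJ zJ.
    by apply: xN => // i lti; apply: zJ; rewrite leq_max lti orbT.
  by apply: (sN y) => // i lti; apply: zJ; rewrite leq_max lti.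
have [_] := nxP _ (LP (phi N)); apply=> J idJ LJ.
have /Is : I (z (phi N)).2 by exists N.+1 => J' _; apply.
apply=> // y ys; apply: (sN y) => // i lti; apply: LJ; last exact: dv_phi.
exact/zL/phi_inc.
Qed.

Section Modules.
Variables (C : natCat) (k : pzRingType) (M : cmod C k).

Lemma cactD n m (f : hom C n m) (x y : cobj M n) :
  cact M f (x + y) = cact M f x + cact M f y.
Proof. by have := cact_linear f 1 x y; rewrite !scale1r. Qed.

Lemma cact0 n m (f : hom C n m) : cact M f (0 : cobj M n) = 0.
Proof. by apply: (addrI (cact M f 0)); rewrite -cactD !addr0. Qed.

Lemma cactZ n m (f : hom C n m) a (x : cobj M n) :
  cact M f (a *: x) = a *: cact M f x.
Proof. by have := cact_linear f a x 0; rewrite cact0 !addr0. Qed.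

Definition gens_sub (gens : seq {n : nat & cobj M n}) (S : csubmod M) :=
  forall d, List.In d gens -> csub S (projT2 d).

Lemma in_generatedP gens n (v : cobj M n) :
  in_generated gens v <-> forall S, gens_sub gens S -> csub S v.
Proof.
by split=> gen_v S gS; apply: gen_v; apply/(List_In_nth (fun d => csub S (projT2 d))).
Qed.

Lemma gen0 gens n : in_generated gens (0 : cobj M n).
Proof. by move=> S _; apply: csub0. Qed.

Lemma genD gens n (x y : cobj M n) :
  in_generated gens x -> in_generated gens y -> in_generated gens (x + y).
Proof. by move=> gx gy S gS; apply: csubD; [apply: gx | apply: gy]. Qed.

Lemma genZ gens n a (x : cobj M n) :
  in_generated gens x -> in_generated gens (a *: x).
Proof. by move=> gx S gS; apply/csubZ/gx. Qed.

Lemma gen_act gens n m (f : hom C n m) (x : cobj M n) :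
  in_generated gens x -> in_generated gens (cact M f x).
Proof. by move=> gx S gS; apply/csub_act/gx. Qed.

Definition generated gens : csubmod M :=
  CSub (@gen0 gens) (@genD gens) (@genZ gens) (@gen_act gens).

Lemma generated_sub gens : gens_sub gens (generated gens).
Proof. by move=> d d_gens; apply/in_generatedP => S; apply. Qed.

Lemma in_generated_trans gens gens' n (v : cobj M n) :
  gens_sub gens (generated gens') -> in_generated gens v -> in_generated gens' v.
Proof. by move=> sub /in_generatedP/(_ _ sub). Qed.

Section Low.
Variables (T : csubmod M) (n : nat) (x : cobj M n).
Variable rho : forall m, hom C n m -> nat.

(* [T + \sum_(rho f < N) k f x], without a finite enumeration of the [f]. *)
Inductive low N m : cobj M m -> Prop :=
| low_base w : csub T w -> low N w
| low_add a f v : (rho f < N)%N -> low N v -> low N (a *: cact M f x + v).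

Lemma lowD N m (u v : cobj M m) : low N u -> low N v -> low N (u + v).
Proof.
move=> + lv; elim=> [w Tw|a f u' ltf _ IHu]; last by rewrite -addrA; apply: low_add.
elim: lv => [w' Tw'|a f v' ltf _ IHv]; first exact/low_base/csubD.
by rewrite addrCA; apply: low_add.
Qed.

Lemma lowZ N m b (v : cobj M m) : low N v -> low N (b *: v).
Proof.
elim=> [w Tw|a f u ltf _ IHu]; first exact/low_base/csubZ.
by rewrite scalerDr scalerA; apply: low_add.
Qed.

Lemma low_leq N N' m (v : cobj M m) : (N <= N')%N -> low N v -> low N' v.
Proof.
move=> leN; elim=> [w Tw|a f u ltf _ IHu]; first exact: low_base.
by apply: low_add => //; apply: leq_trans leN.
Qed.

Lemma low_act N N' m p (g : hom C m p) (v : cobj M m) :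
    (forall f, (rho f < N)%N -> (rho (compc g f) < N')%N) ->
  low N v -> low N' (cact M g v).
Proof.
move=> mono; elim=> [w Tw|a f u ltf _ IHu]; first exact/low_base/csub_act.
by rewrite cactD cactZ -cact_comp; apply: low_add => //; apply: mono.
Qed.

(** Only finitely many translates of [x] occur, so some bound survives for any [g]; hence the union
    of [low N] over [N] is a submodule. *)
Lemma low_act_bound N m p (g : hom C m p) (v : cobj M m) :
  low N v -> exists N', low N' (cact M g v).
Proof.
elim=> [w Tw|a f u ltf _ [N' IHu]]; first by exists 0%N; apply/low_base/csub_act.
exists (maxn N' (rho (compc g f)).+1); rewrite cactD cactZ -cact_comp.
by apply: low_add; [exact: leq_maxr | apply: low_leq IHu; exact: leq_maxl].
Qed.

(** Injectivity leaves at most one morphism of rank [N], so all terms of that rank merge into one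
    leading term. *)
Lemma lowS N m (v : cobj M m) : (forall m, injective (@rho m)) -> low N.+1 v ->
  low N v \/ exists f a u, [/\ rho f = N, low N u & v = a *: cact M f x + u].
Proof.
move=> rho_inj; elim=> [w Tw|a f u ltf _ [lu|[f' [b [w [rf' lw ->]]]]]].
- by left; apply: low_base.
- move: ltf; rewrite ltnS leq_eqVlt => /orP[/eqP rf|ltf].
    by right; exists f, a, u.
  by left; apply: low_add.
- right; move: ltf; rewrite ltnS leq_eqVlt => /orP[/eqP rf|ltf].
    exists f, (a + b), w; split=> //; rewrite scalerDl -addrA.
    by rewrite (rho_inj _ f f') // rf rf'.
  by exists f', b, (a *: cact M f x + w); split; [| exact: low_add | by rewrite addrCA].
Qed.

End Low.
End Modules.

(** * Groebner categories and their Noetherianity *)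

Definition divides (C : natCat) n (rho : forall m, hom C n m -> nat)
    (f f' : {m : nat & hom C n m}) :=
  exists2 g : hom C (projT1 f) (projT1 f'), compc g (projT2 f) = projT2 f' &
    forall f1, (rho _ f1 < rho _ (projT2 f))%N ->
      (rho _ (compc g f1) < rho _ (projT2 f'))%N.

(** An injective rank into [nat] encodes a well-order on each hom-set out of [n]. The monotonicity
    clause of [divides] makes [g] carry leading term [f] to leading term [f']. *)
Definition groebner (C : natCat) := forall n,
  exists2 rho : forall m, hom C n m -> nat, forall m, injective (rho m) &
    forall z : nat -> {m : nat & hom C n m}, exists2 phi, increasing phi &
      forall i j, (i < j)%N -> divides rho (z (phi i)) (z (phi j)).

(** Passes from [T] to [T] enlarged by [x]: finitely many elements of [S] account for all leading
    coefficients, and cancelling leading terms with them lowers the rank until an element of [T]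
    remains, which [G] handles. *)
Lemma noetherian_step (C : natCat) (k : pzRingType) (M : cmod C k)
    (S T : csubmod M) n (x : cobj M n) (rho : forall m, hom C n m -> nat) G :
    left_noetherian k -> (forall m, injective (rho m)) ->
    (forall z : nat -> {m : nat & hom C n m}, exists2 phi, increasing phi &
      forall i j, (i < j)%N -> divides rho (z (phi i)) (z (phi j))) ->
    gens_sub G S -> (forall m (v : cobj M m), csub S v -> csub T v -> in_generated G v) ->
  exists2 G', gens_sub G' S & forall N m (v : cobj M m),
    csub S v -> low T x rho N v -> in_generated G' v.
Proof.
move=> noeth rho_inj chain GS GT.
(* Monomials are paired with vectors, so that the finite list found for [P] supplies generators and
   not only leading terms. *)
pose D := {m : nat & (hom C n m * cobj M m)%type}.
pose mono (d : D) : {m : nat & hom C n m} := existT _ (projT1 d) (projT2 d).1.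
pose vec (d : D) : {m : nat & cobj M m} := existT _ (projT1 d) (projT2 d).2.
pose P (y : D * k) := csub S (projT2 (vec y.1)) /\
  exists2 u, low T x rho (rho _ (projT2 (mono y.1))) u &
    projT2 (vec y.1) = y.2 *: cact M (projT2 (mono y.1)) x + u.
have [F FP lead] := @left_ideal_finite_leading k D
  (fun d d' => divides rho (mono d) (mono d')) P noeth (fun z => chain (mono \o z)).
pose G' := [seq vec y.1 | y <- F] ++ G.
have G'S : gens_sub G' S.
  move=> d /(List.in_app_or _ _ _)[|/GS//].
  by move=> /(List.in_map_iff _ _ _)[y [<- /FP[]]].
have genF y : List.In y F -> in_generated G' (projT2 (vec y.1)).
  move=> yF; apply: (generated_sub (d := vec y.1)).
  by apply/List.in_or_app; left; apply/List.in_map_iff; exists y.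
exists G' => // N; elim: N => [|N IHN] m v Sv lv.
  apply: (@in_generated_trans _ _ _ G) => [d dG|].
    by apply: generated_sub; apply/List.in_or_app; right.
  by apply: GT Sv _; case: lv.
have [lNv|[f [a [u [rf lu vE]]]]] := lowS rho_inj lv; first exact: IHN.
(* The coefficients at [f], modulo lower terms, of elements already generated; once [a] is among
   them, the leading term of [v] can be cancelled. *)
pose J c := exists2 v', in_generated G' v' &
  exists2 u', low T x rho N u' & v' = c *: cact M f x + u'.
have idJ : left_ideal J.
  split=> [|c c' [w gw [u1 lu1 wE]] [w' gw' [u2 lu2 wE']]|b c [w gw [u1 lu1 wE]]].
  - exists 0; first exact: gen0.
    by exists 0; [apply/low_base/csub0 | rewrite scale0r addr0].
  - exists (w + w'); first exact: genD.
    by exists (u1 + u2); [exact: lowD | rewrite wE wE' scalerDl addrACA].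
  - exists (b *: w); first exact: genZ.
    by exists (b *: u1); [exact: lowZ | rewrite wE scalerDr scalerA].
have [|y yF [g /= gf g_mono]|v' gv' [u' lu' v'E]] :=
  lead (existT _ m (f, v), a) _ J idJ.
- by split=> //=; exists u; rewrite ?rf.
- have [_ [u1 lu1 yE]] := FP y yF.
  exists (cact M g (projT2 (vec y.1))); first exact/gen_act/genF.
  exists (cact M g u1); last by rewrite yE cactD cactZ -cact_comp gf.
  by apply: low_act lu1 => f1 /g_mono; rewrite rf.
rewrite -(subrK v' v); apply: genD => //; apply: IHN.
  rewrite -scaleN1r; apply: csubD => //; apply: csubZ.
  by move/in_generatedP: gv'; apply.
rewrite vE v'E opprD addrACA subrr add0r -scaleN1r.
by apply: lowD => //; apply: lowZ.
Qed.

Theorem groebner_noetherian (C : natCat) (k : pzRingType) :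
  left_noetherian k -> groebner C -> locally_noetherian C k.
Proof.
move=> noeth groebC M [gens genM] S.
suff [G GS genG] : exists2 G, gens_sub G S & forall m (v : cobj M m),
    csub S v -> in_generated gens v -> in_generated G v.
  exists G; split; first by apply/(List_In_nth (fun d => csub S (projT2 d))).
  move=> m v; split=> [Sv|/in_generatedP]; first exact: genG.
  exact.
elim: gens {genM} => [|[n x] gens [G GS genG]].
  by exists [::] => // m v _; apply/in_generated_trans.
have [rho rho_inj chain] := groebC n.
have [G' G'S lowG'] := noetherian_step x noeth rho_inj chain GS (T := generated gens) genG.
exists G' => // m v Sv.
(* This union is a submodule containing [x], as its own translate by the identity, and the earlier
   generators; so every generated [v] lies in some [low N]. *)
pose U m (v : cobj M m) := exists N, low (generated gens) x rho N v.
have U0 m' : U m' 0 by exists 0%N; apply/low_base/gen0.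
have UD m' (u w : cobj M m') : U m' u -> U m' w -> U m' (u + w).
  move=> [N lu] [N' lw]; exists (maxn N N').
  by apply: lowD; [apply: low_leq lu; exact: leq_maxl | apply: low_leq lw; exact: leq_maxr].
have UZ m' a (u : cobj M m') : U m' u -> U m' (a *: u).
  by move=> [N lu]; exists N; apply: lowZ.
have Uact m' p (f : hom C m' p) (u : cobj M m') : U m' u -> U p (cact M f u).
  by move=> [N lu]; apply: low_act_bound lu.
move=> /in_generatedP/(_ (CSub U0 UD UZ Uact))[d /= [<-|d_gens]|N lv].
- exists (rho _ (idc C n)).+1.
  have low0 N : low (generated gens) x rho N (0 : cobj M n) by apply/low_base/csub0.
  by have := low_add 1 (ltnSn (rho _ (idc C n))) (low0 _); rewrite cact_id scale1r addr0.
- by exists 0%N; apply/low_base/generated_sub.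
exact: lowG' lv.
Qed.

(** The restriction of [M'] along [phi] is generated by the translates of [gens] by the finitely
    many [h]. A submodule over [C'] restricts to one over [C], and generators of the latter generate
    the former. *)
Lemma noetherian_transfer (C C' : natCat) (k : pzRingType)
    (phi : forall n m, hom C n m -> hom C' n m) :
    (forall n, phi _ _ (idc C n) = idc C' n) ->
    (forall n m p (g : hom C m p) (f : hom C n m),
      phi _ _ (compc g f) = compc (phi _ _ g) (phi _ _ f)) ->
    (forall n, exists hs : seq {p : nat & hom C' n p}, forall m (f : hom C' n m),
      exists2 h, List.In h hs & exists g, f = compc (phi _ m g) (projT2 h)) ->
  locally_noetherian C k -> locally_noetherian C' k.
Proof.
move=> phi1 phiM factor noethC M' [gens genM'] S'.
pose M := @CMod C k (cobj M') (fun n m f => cact M' (phi n m f))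
  (fun n m f => cact_linear (phi n m f))
  (fun n x => etrans (congr1 (fun f => cact M' f x) (phi1 n)) (cact_id x))
  (fun n m p g f x => etrans (congr1 (fun h => cact M' h x) (phiM n m p g f))
                             (cact_comp (phi m p g) (phi n m f) x)).
pose restr (S : csubmod M') : csubmod M := @CSub C k M (fun n => csub S)
  (csub0 S) (@csubD _ _ _ S) (@csubZ _ _ _ S)
  (fun n m f => @csub_act _ _ _ S n m (phi n m f)).
have [|G [GS genG]] := noethC M _ (restr S').
  pose hs n := sval (constructive_indefinite_description _ (factor n)).
  have hsP n := svalP (constructive_indefinite_description _ (factor n)).
  exists (List.flat_map (fun d => [seq existT (cobj M') (projT1 h)
    (cact M' (projT2 h) (projT2 d)) | h <- hs (projT1 d)]) gens).
  move=> n v; apply/in_generatedP => S genS.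
  (* Unlike [S], this is stable under all of [C']; by the factorization it contains [gens], hence
     everything. *)
  pose U n (u : cobj M' n) := forall m (f : hom C' n m), csub S (cact M' f u : cobj M m).
  have U0 p : U p 0 by move=> m f; rewrite cact0; apply: (csub0 S).
  have UD p (u w : cobj M' p) : U p u -> U p w -> U p (u + w).
    by move=> Uu Uw m f; rewrite cactD; apply: (@csubD _ _ _ S); [apply: Uu | apply: Uw].
  have UZ p a (u : cobj M' p) : U p u -> U p (a *: u).
    by move=> Uu m f; rewrite cactZ; apply: (@csubZ _ _ _ S); apply: Uu.
  have Uact p q (f : hom C' p q) (u : cobj M' p) : U p u -> U q (cact M' f u).
    by move=> Uu m g; rewrite -cact_comp; apply: Uu.
  have /in_generatedP/(_ (CSub U0 UD UZ Uact))/= Uv := genM' n v.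
  rewrite -[v]cact_id; apply: Uv => d d_gens m f.
  have [h h_hs [g ->]] := hsP _ _ f; rewrite cact_comp.
  apply: (@csub_act _ _ _ S _ _ g (cact M' (projT2 h) (projT2 d))).
  apply: (genS (existT _ (projT1 h) _)); apply/List.in_flat_map.
  by exists d; split=> //; apply/List.in_map_iff; exists h.
exists G; split=> // m v; split=> [/genG gv S GS'|].
  exact: (gv (restr S)).
by apply.
Qed.

(** * Words of VIC-morphisms *)

(** Position 0 is the most significant digit: for digits below [q], comparing values is
    lexicographic comparison. *)
Definition base_value q m (d : 'I_m -> nat) := (\sum_(i < m) d i * q ^ (m - i.+1))%N.

Lemma base_valueS q m (d : 'I_m.+1 -> nat) :
  base_value q d = (d ord0 * q ^ m + base_value q (d \o lift ord0))%N.
Proof. by rewrite /base_value big_ord_recl subn1. Qed.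

Lemma base_value_ub q m (d : 'I_m -> nat) :
  (forall i, (d i < q)%N) -> (base_value q d < q ^ m)%N.
Proof.
elim: m d => [|m IHm] d ltd; first by rewrite /base_value big_ord0.
rewrite base_valueS; have /(_ (fun i => ltd _))IH := IHm (d \o lift ord0).
apply: (@leq_trans ((d ord0).+1 * q ^ m)); first by rewrite mulSn addnC ltn_add2r.
by rewrite expnS leq_mul2r ltd orbT.
Qed.

Lemma ltn_divmod_lex Q a b x y : (x < Q)%N -> (y < Q)%N ->
  (a * Q + x < b * Q + y)%N = (a < b)%N || (a == b) && (x < y)%N.
Proof.
move=> ltx lty; case: (ltngtP a b) => [lt_ab|lt_ba|->] /=; last by rewrite ltn_add2l.
  apply: (@leq_trans (a.+1 * Q)); first by rewrite mulSn addnC ltn_add2r.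
  by apply: leq_trans (leq_addr _ _); rewrite leq_mul2r lt_ab orbT.
apply/negbTE; rewrite -leqNgt; apply: ltnW.
apply: (@leq_trans (b.+1 * Q)); first by rewrite mulSn addnC ltn_add2r.
by apply: leq_trans (leq_addr _ _); rewrite leq_mul2r lt_ba orbT.
Qed.

Lemma base_value_lt q m (d d' : 'I_m -> nat) :
    (forall i, (d i < q)%N) -> (forall i, (d' i < q)%N) ->
  (base_value q d < base_value q d')%N <->
  exists2 t : 'I_m, forall u : 'I_m, (u < t)%N -> d u = d' u & (d t < d' t)%N.
Proof.
elim: m d d' => [|m IHm] d d' ltd ltd'.
  by rewrite /base_value !big_ord0; split=> // -[[]].
have ltdS i : ((d \o lift ord0) i < q)%N by apply: ltd.
have ltd'S i : ((d' \o lift ord0) i < q)%N by apply: ltd'.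
rewrite !base_valueS ltn_divmod_lex ?base_value_ub //; split.
  case/orP=> [lt0|/andP[/eqP eq0 /(IHm _ _ ltdS ltd'S)[t eqt ltt]]].
    by exists ord0.
  exists (lift ord0 t) => // u; case: (unliftP ord0 u) => [v ->|-> //].
  by rewrite ltnS => /eqt.
case=> t; case: (unliftP ord0 t) => [v ->|->] eqt ltt; last by rewrite ltt.
rewrite (eqt ord0) // eqxx; apply/orP; right; apply/(IHm _ _ ltdS ltd'S).
by exists v => // u lt_uv; apply: (eqt (lift ord0 u)).
Qed.

Lemma base_value_inj q m (d d' : 'I_m -> nat) :
    (forall i, (d i < q)%N) -> (forall i, (d' i < q)%N) ->
  base_value q d = base_value q d' -> d =1 d'.
Proof.
elim: m d d' => [|m IHm] d d' ltd ltd' eqv; first by case.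
have ltdS i : ((d \o lift ord0) i < q)%N by apply: ltd.
have ltd'S i : ((d' \o lift ord0) i < q)%N by apply: ltd'.
have Q_gt0 := leq_ltn_trans (leq0n _) (base_value_ub ltdS).
move: eqv; rewrite !base_valueS => eqv.
have eq0 : d ord0 = d' ord0.
  by have := congr1 (divn^~ (q ^ m)%N) eqv; rewrite /= !divnMDl // !divn_small ?base_value_ub // !addn0.
move: eqv; rewrite eq0 => /addnI/(IHm _ _ ltdS ltd'S) eqS i.
by case: (unliftP ord0 i) => [j ->|->//]; apply: eqS.
Qed.

(** * Morphisms out of [[R^n]] as words *)

Section VIC.
Variables (R : finPzRingType) (n : nat).

Definition pivot m (B : 'M[R]_(n, m)) (t : 'I_m) : bool :=
  [forall u : 'I_m, (u < t)%N ==> (col u B != col t B)].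

Definition fibre m (B : 'M[R]_(n, m)) (b : 'cV[R]_n) : 'rV[R]_m :=
  \row_j (col j B == b)%:R.

Definition fibre_sum m (f : VIC_hom R n m) b : 'rV[R]_n := fibre (sval f).2 b *m (sval f).1.

(* The rows of the injection at pivots are determined by the other rows and by
   the sums over the fibres of the column word, and these sums are invariant
   under the substitutions below; so pivots carry the sum instead of the row. *)
Definition alpha m (f : VIC_hom R n m) (t : 'I_m) : 'rV[R]_n :=
  if pivot (sval f).2 t then fibre_sum f (col t (sval f).2) else row t (sval f).1.

(** The flag tells whether [alpha] holds a fibre sum or a row, and prevents an inserted letter from
    copying a pivot. *)
Definition letter m (f : VIC_hom R n m) (t : 'I_m) : 'cV[R]_n * 'rV[R]_n * bool :=
  (col t (sval f).2, alpha f t, pivot (sval f).2 t).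

Lemma pivotP m (B : 'M[R]_(n, m)) (t : 'I_m) :
  reflect (forall u : 'I_m, (u < t)%N -> col u B <> col t B) (pivot B t).
Proof.
apply: (iffP forallP) => [piv u ltu|piv u].
  by apply/eqP; have := piv u; rewrite ltu.
by apply/implyP => /piv/eqP.
Qed.

Lemma pivot_exists m (B : 'M[R]_(n, m)) (t : 'I_m) :
  exists2 s : 'I_m, pivot B s & col s B = col t B /\ (s <= t)%N.
Proof.
have [s /eqP eq_s min_s] := @arg_minnP _ t (fun s => col s B == col t B) val (eqxx _).
exists s; last by split=> //; apply: min_s.
apply/pivotP => u lt_us eq_us; have := min_s u; rewrite eq_us eq_s eqxx => /(_ isT).
by rewrite leqNgt lt_us.
Qed.

Lemma pivot_unique m (B : 'M[R]_(n, m)) (s t : 'I_m) :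
  pivot B s -> pivot B t -> col s B = col t B -> s = t.
Proof.
move=> /pivotP piv_s /pivotP piv_t eq_st; apply/val_inj.
by case: (ltngtP s t) => // [/piv_t[]|/piv_s[]].
Qed.

Lemma pivot_eq m (B B' : 'M[R]_(n, m)) (t : 'I_m) :
  (forall u : 'I_m, (u <= t)%N -> col u B = col u B') -> pivot B t = pivot B' t.
Proof.
move=> eqB; apply: eq_forallb => u; case: ltnP => //= ltu.
by rewrite !eqB // ltnW.
Qed.

Lemma VIC_hom_inj m (f f' : VIC_hom R n m) : sval f = sval f' -> f = f'.
Proof.
case: f f' => [p pP] [p' p'P] /= eqp; rewrite -eqp in p'P *.
by congr exist; apply: eq_irrelevance.
Qed.

Lemma fibre_mul_pivot m (B : 'M[R]_(n, m)) (X : 'M[R]_(m, n)) t : pivot B t ->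
  (forall u, ~~ pivot B u -> row u X = 0) -> fibre B (col t B) *m X = row t X.
Proof.
move=> piv_t X0; apply/rowP => j; rewrite !mxE (bigD1 t) //= big1 ?addr0 => [|u ne_ut].
  by rewrite mxE eqxx mul1r.
rewrite mxE; case: eqP => [eq_ut|]; last by rewrite mul0r.
have /X0/rowP/(_ j) : ~~ pivot B u.
  by apply: contra ne_ut => piv_u; apply/eqP; apply: pivot_unique eq_ut.
by rewrite !mxE => ->; rewrite mulr0.
Qed.

(** The difference of the two injections vanishes outside pivot rows, and each fibre has a single
    pivot, so the equal fibre sums force the pivot rows to agree too. *)
Lemma word_inj m (f f' : VIC_hom R n m) :
    (forall t, col t (sval f).2 = col t (sval f').2) ->
  alpha f =1 alpha f' -> f = f'.
Proof.
move=> eqcol eqa.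
have eqB : (sval f).2 = (sval f').2.
  by apply/matrixP => i j; have /matrixP/(_ i 0) := eqcol j; rewrite !mxE.
suff eqA : (sval f).1 = (sval f').1.
  by apply: VIC_hom_inj; rewrite [sval f]surjective_pairing eqA eqB -surjective_pairing.
apply/row_matrixP => t; have := eqa t; rewrite /alpha -eqB; case: ifP => // piv_t.
rewrite /fibre_sum -eqB => eq_sum; apply/eqP; rewrite -subr_eq0; apply/eqP.
pose X := (sval f).1 - (sval f').1.
have X0 u : ~~ pivot (sval f).2 u -> row u X = 0.
  move=> npiv_u; have := eqa u; rewrite /alpha -eqB (negbTE npiv_u) => eq_u.
  by rewrite linearB /= eq_u subrr.
rewrite -linearB -/X -[RHS](subrr (fibre (sval f).2 (col t (sval f).2) *m (sval f).1)).
rewrite {2}eq_sum -mulmxBr -/X; by symmetry; apply: fibre_mul_pivot.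
Qed.

End VIC.

(** * Morphisms that insert letters *)

Section Substitution.
Variables (R : finPzRingType) (m p : nat).
Variables (e : 'I_m -> 'I_p) (sigma tau : 'I_p -> 'I_m).
Hypotheses (sigmaK : cancel e sigma) (tauK : cancel e tau).

(* [sigma] duplicates columns of the projection and [tau] rows of the injection;
   the correction term of [subst_inj] is concentrated on the rows in the image
   of [e], and vanishes on those of them whose fibre under [sigma] is trivial. *)
Definition subst_proj : 'M[R]_(m, p) := colsub sigma 1%:M.
Definition subst_sect : 'M[R]_(p, m) := colsub e 1%:M.
Definition subst_inj : 'M[R]_(p, m) :=
  rowsub tau 1%:M + subst_sect *m (1%:M - subst_proj *m rowsub tau 1%:M).

(** [subst_sect] is a section of [subst_proj], so the correction term supplies exactly what
    [subst_proj *m rowsub tau 1%:M] lacks. *)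
Lemma subst_injK : subst_proj *m subst_inj = 1%:M.
Proof.
have projK : subst_proj *m subst_sect = 1%:M.
  by rewrite mulmx_colsub mulmx1; apply/matrixP => i j; rewrite !mxE sigmaK.
by rewrite mulmxDr mulmxA projK mul1mx addrC subrK.
Qed.

Definition subst : VIC_hom R m p := exist _ (subst_inj, subst_proj) subst_injK.

Variables (n : nat).

Lemma col_subst (B : 'M[R]_(n, m)) j : col j (B *m subst_proj) = col (sigma j) B.
Proof. by rewrite mulmx_colsub mulmx1; apply/colP => i; rewrite !mxE. Qed.

Lemma mul_subst_inj (A : 'M[R]_(m, n)) :
  subst_inj *m A = rowsub tau A + subst_sect *m (A - subst_proj *m rowsub tau A).
Proof.
by rewrite mulmxDl mul_rowsub_mx mul1mx -mulmxA mulmxBl mul1mx -mulmxA mul_rowsub_mx mul1mx.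
Qed.

Lemma row_subst_notin (A : 'M[R]_(m, n)) j :
  (forall u, j <> e u) -> row j (subst_inj *m A) = row (tau j) A.
Proof.
move=> nej; rewrite mul_subst_inj linearD /= [X in _ + X](_ : _ = 0).
  by rewrite addr0; apply/rowP => i; rewrite !mxE.
apply/rowP => i; rewrite !mxE big1 // => u _; rewrite mxE.
by rewrite [in X in X * _]mxE; case: eqP (nej u) => // _ _; rewrite mul0r.
Qed.

Lemma row_subst_fixed (A : 'M[R]_(m, n)) u :
  (forall j, sigma j = u -> j = e u) -> row (e u) (subst_inj *m A) = row u A.
Proof.
move=> fib_u; rewrite mul_subst_inj; apply/rowP => i.
rewrite !mxE (bigD1 u) //= big1 ?addr0 => [|v ne_vu]; last first.
  by rewrite !mxE (can_eq sigmaK) eq_sym (negbTE ne_vu) mul0r.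
rewrite !mxE eqxx mul1r (bigD1 (e u)) //= big1 => [|j ne_j].
  by rewrite !mxE sigmaK tauK eqxx mul1r addr0 addrC subrK.
rewrite !mxE; case: eqP => [eq_u|]; last by rewrite mul0r.
by rewrite (fib_u j) ?eqxx in ne_j.
Qed.

Variable f : VIC_hom R n m.
Let gf : VIC_hom R n p := @compc (VIC_cat R) n m p subst f.

Lemma fibre_sum_subst b : fibre_sum gf b = fibre_sum f b.
Proof.
rewrite /fibre_sum /= (_ : fibre _ b = fibre (sval f).2 b *m subst_proj).
  by rewrite mulmxA -(mulmxA _ subst_proj) subst_injK mulmx1.
by rewrite [RHS]mulmx_colsub mulmx1; apply/rowP => j; rewrite !mxE col_subst.
Qed.

Hypothesis e_mono : {mono e : u v / (u < v)%N}.
Hypothesis e_sigma : forall j, (e (sigma j) <= j)%N.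

(** By [e_sigma] a copied column never precedes its original, so first occurrences stay first. *)
Lemma pivot_subst (B : 'M[R]_(n, m)) u : pivot (B *m subst_proj) (e u) = pivot B u.
Proof.
apply/pivotP/pivotP => piv v lt_v.
  by have := piv (e v); rewrite e_mono !col_subst !sigmaK; apply.
rewrite !col_subst sigmaK; apply: piv.
by rewrite -e_mono; apply: leq_ltn_trans lt_v.
Qed.

Lemma pivot_subst_notin (B : 'M[R]_(n, m)) j :
  (forall u, j <> e u) -> pivot (B *m subst_proj) j = false.
Proof.
move=> nej; apply/pivotP => /(_ (e (sigma j))); rewrite !col_subst sigmaK; apply=> //.
by rewrite ltn_neqAle e_sigma andbT; apply/eqP => /val_inj/esym/nej.
Qed.

(** Only a pivot may have several preimages under [sigma]; its row may change, but its [alpha] is an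
    invariant fibre sum. *)
Lemma alpha_subst u :
    (~~ pivot (sval f).2 u -> forall j, sigma j = u -> j = e u) ->
  alpha gf (e u) = alpha f u.
Proof.
move=> fib_u; rewrite /alpha /= pivot_subst; case: ifP fib_u => piv_u fib_u.
  by rewrite fibre_sum_subst col_subst sigmaK.
by rewrite row_subst_fixed //; apply: fib_u.
Qed.

Lemma alpha_subst_notin j : (forall u, j <> e u) -> ~~ pivot (sval f).2 (tau j) ->
  alpha gf j = alpha f (tau j).
Proof.
by move=> nej npiv; rewrite /alpha /= pivot_subst_notin // (negbTE npiv) row_subst_notin.
Qed.

End Substitution.

(** * Subword embeddings and divisibility of morphisms *)

Lemma subseq_embedding (T : eqType) m p (w : 'I_m -> T) (w' : 'I_p -> T) :
    subseq (codom w) (codom w') ->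
  exists2 e : 'I_m -> 'I_p, {mono e : u v / (u < v)%N} & forall u, w' (e u) = w u.
Proof.
case/subseqP=> b _; rewrite !codomE -map_mask; set L := mask b _ => eqL.
have szL : size L == m by rewrite -(size_map w') -eqL size_map size_enum_ord.
have sortL : sorted (fun i j : 'I_p => (i < j)%N) L.
  apply: sorted_mask => [i j k|]; first exact: ltn_trans.
  by have := iota_ltn_sorted 0 p; rewrite -val_enum_ord sorted_map.
pose e u := tnth (Tuple szL) u.
have e_homo (u v : 'I_m) : (u < v)%N -> (e u < e v)%N.
  move=> lt_uv; rewrite /e !(tnth_nth (e u)) /=.
  by apply: (sorted_ltn_nth _ _ sortL); rewrite ?inE ?(eqP szL) //; apply: ltn_trans.
exists e => u => [v|].
  case: (ltngtP u v) => [/e_homo //|/e_homo lt_e|/val_inj->]; last exact: ltnn.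
    by apply/negbTE; rewrite -leqNgt ltnW.
have := congr1 (fun s => nth (w u) s u) eqL.
rewrite (nth_map u) ?size_enum_ord // nth_ord_enum (nth_map (e u)) ?(eqP szL) // => ->.
by congr w'; apply: tnth_nth.
Qed.

Section GroebnerVIC.
Variables (R : finPzRingType) (n : nat).

Let N := #|{: 'rV[R]_n}|.

(** The column is the more significant part: at a position where the columns of two morphisms
    differ, their pivots may differ too, and [alpha] is then not controlled under substitution. *)
Definition digit m (f : VIC_hom R n m) (t : 'I_m) : nat :=
  enum_rank (col t (sval f).2) * N + enum_rank (alpha f t).

Definition VIC_rank m (f : VIC_hom R n m) : nat :=
  base_value (#|{: 'cV[R]_n}| * N) (digit f).

Lemma digit_ub m (f : VIC_hom R n m) t : (digit f t < #|{: 'cV[R]_n}| * N)%N.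
Proof.
have := ltn_ord (enum_rank (col t (sval f).2)).
have := ltn_ord (enum_rank (alpha f t)); rewrite -/N => lta ltc.
apply: (@leq_trans ((enum_rank (col t (sval f).2)).+1 * N)).
  by rewrite /digit mulSn addnC ltn_add2r.
by rewrite leq_mul2r ltc orbT.
Qed.

Lemma digit_lt m (f f' : VIC_hom R n m) t p (g g' : VIC_hom R n p) s :
    col s (sval g).2 = col t (sval f).2 -> col s (sval g').2 = col t (sval f').2 ->
    (col t (sval f).2 = col t (sval f').2 ->
      alpha g s = alpha f t /\ alpha g' s = alpha f' t) ->
  (digit f t < digit f' t)%N -> (digit g s < digit g' s)%N.
Proof.
rewrite /digit !ltn_divmod_lex ?ltn_ord // => -> -> eqa.
case/orP=> [->//|/andP[eqc]]; have [/val_inj/enum_rank_inj/eqa[-> ->]] := eqP eqc.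
by rewrite eqc => ->; rewrite orbT.
Qed.

Lemma digit_inj m (f f' : VIC_hom R n m) t : digit f t = digit f' t ->
  col t (sval f).2 = col t (sval f').2 /\ alpha f t = alpha f' t.
Proof.
have N_gt0 : (0 < N)%N by apply: leq_ltn_trans (ltn_ord (enum_rank (alpha f t))).
move=> eqd; have := congr1 (divn^~ N) eqd; have := congr1 (modn^~ N) eqd.
rewrite /digit !modnMDl !divnMDl // !divn_small ?modn_small ?ltn_ord // !addn0.
by move=> /val_inj/enum_rank_inj-> /val_inj/enum_rank_inj->.
Qed.

Lemma VIC_rank_inj m : injective (@VIC_rank m).
Proof.
move=> f f' /(base_value_inj (digit_ub f) (digit_ub f')) eqd.
by apply: word_inj => t; have [] := digit_inj (eqd t).
Qed.

Lemma VIC_rank_lt m (f f' : VIC_hom R n m) :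
  (VIC_rank f < VIC_rank f')%N <->
  exists2 t : 'I_m, forall u : 'I_m, (u < t)%N ->
    col u (sval f).2 = col u (sval f').2 /\ alpha f u = alpha f' u &
    (digit f t < digit f' t)%N.
Proof.
have P := base_value_lt (digit_ub f) (digit_ub f').
split=> [/P[t eqt ltt]|[t eqt ltt]]; first by exists t => // u /eqt/digit_inj.
by apply/P; exists t => // u /eqt[eqc eqa]; rewrite /digit eqc eqa.
Qed.

(** An extra position [j] takes its column, through [sigma], from the pivot of that column, and its
    row, through [tau], from an earlier non-pivot copy of its letter. This substitution sends [f] to
    [f'] and moves a first difference from [t] to [e t]. *)
Lemma embedding_divides m p (f : VIC_hom R n m) (f' : VIC_hom R n p) (e : 'I_m -> 'I_p) :
    {mono e : u v / (u < v)%N} -> (forall u, letter f' (e u) = letter f u) ->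
    (forall j, (forall u, j <> e u) -> exists2 u, (e u < j)%N & letter f u = letter f' j) ->
  divides (C := VIC_cat R) (fun m => @VIC_rank m) (existT _ m f) (existT _ p f').
Proof.
move=> e_mono e_letter e_dup.
have e_inj : injective e.
  move=> u v eq_uv; apply: val_inj => /=.
  by case: (ltngtP u v) => //; rewrite -e_mono eq_uv ltnn.
pose B := (sval f).2.
have dup j : exists st : 'I_m * 'I_m, (forall u, j = e u -> st = (u, u)) /\
    ((forall u, j <> e u) -> [/\ pivot B st.1, ~~ pivot B st.2, (st.1 <= st.2)%N,
      col st.1 B = col st.2 B & (e st.2 < j)%N /\ letter f st.2 = letter f' j]).
  have [/existsP[u /eqP->]|/existsP noj] := boolP [exists u, j == e u].
    by exists (u, u); split=> [v /e_inj->|/(_ u)].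
  have nej u : j <> e u by move=> eqj; apply: noj; exists u; apply/eqP.
  have [t lt_t eq_t] := e_dup j nej.
  have [s piv_s [eq_st le_st]] := pivot_exists B t.
  exists (s, t); split=> [u /nej //|_]; split=> //=.
  (* If [t] were a pivot, the flag would make [j] one, although its column already occurs at
     [e t]. *)
  apply/negP => piv_t; case: (eq_t) => eqc _ eqp.
  have /pivotP/(_ _ lt_t) : pivot (sval f').2 j by rewrite -eqp.
  by case: (e_letter t) => -> _ _; apply.
have {dup}[st stP] := fin_all_exists dup.
pose sigma (j : 'I_p) := (st j).1; pose tau (j : 'I_p) := (st j).2.
have sigmaK : cancel e sigma by move=> u; rewrite /sigma ((stP _).1 u).
have tauK : cancel e tau by move=> u; rewrite /tau ((stP _).1 u).
have inP j : (exists u, j = e u) \/ (forall u, j <> e u).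
  have [/existsP[u /eqP->]|/existsP noj] := boolP [exists u, j == e u].
    by left; exists u.
  by right=> u eqj; apply: noj; exists u; apply/eqP.
have e_leq (u v : 'I_m) : (u <= v)%N -> (e u <= e v)%N.
  by move=> le_uv; rewrite leqNgt e_mono -leqNgt.
have e_tau j : (e (tau j) <= j)%N.
  by case: (inP j) => [[u ->]|/(stP j).2[_ _ _ _ [/ltnW]]//]; rewrite tauK.
have e_sigma j : (e (sigma j) <= j)%N.
  case: (inP j) => [[u ->]|/(stP j).2[_ _ le_st _ _]]; first by rewrite sigmaK.
  exact: leq_trans (e_leq _ _ le_st) (e_tau j).
have fib u : ~~ pivot B u -> forall j, sigma j = u -> j = e u.
  move=> npiv j eqj; case: (inP j) => [[v eq_v]|/(stP j).2[piv _ _ _ _]].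
    by move: eqj; rewrite eq_v sigmaK => ->.
  by rewrite -eqj piv in npiv.
pose g := subst R tau sigmaK.
pose act (h : VIC_hom R n m) : VIC_hom R n p := @compc (VIC_cat R) n m p g h.
have col_act h j : col j (sval (act h)).2 = col (sigma j) (sval h).2.
  exact: col_subst.
have gf : act f = f'.
  apply: word_inj => j.
    rewrite col_act; case: (inP j) => [[u ->]|/(stP j).2[_ _ _ eqc [_ []]]].
      by rewrite sigmaK; case: (e_letter u).
    by rewrite -/(sigma j) in eqc *; rewrite eqc.
  case: (inP j) => [[u ->]|nej].
    by rewrite alpha_subst //; [case: (e_letter u) | exact: fib].
  have [_ npiv _ _ [_ [_ eqa _]]] := (stP j).2 nej.
  by rewrite alpha_subst_notin.
exists g => //= f1 /VIC_rank_lt[t eqt ltt]; rewrite -gf; apply/VIC_rank_lt.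
(* The columns agree before [t], hence so do the pivots; at [t] itself this needs equal columns
   there. *)
have eq_piv (u : 'I_m) : (u <= t)%N -> col t (sval f1).2 = col t (sval f).2 \/ (u < t)%N ->
    pivot (sval f1).2 u = pivot B u.
  move=> le_ut eq_or; apply: pivot_eq => v le_vu.
  case: (ltngtP v t) (leq_trans le_vu le_ut) => // [/eqt[]//|/val_inj eq_vt] _.
  case: eq_or => [|lt_ut]; first by rewrite eq_vt.
  by rewrite eq_vt leqNgt lt_ut in le_vu.
exists (e t) => [j lt_j|].
  have lt_s : (sigma j < t)%N by rewrite -e_mono; apply: leq_ltn_trans lt_j.
  have lt_t : (tau j < t)%N by rewrite -e_mono; apply: leq_ltn_trans lt_j.
  split; first by rewrite !col_act; case: (eqt _ lt_s).
  case: (inP j) => [[u eq_j]|nej].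
    have lt_u : (u < t)%N by rewrite -e_mono -eq_j.
    rewrite eq_j !alpha_subst //; first by case: (eqt _ lt_u).
      exact: fib.
    by rewrite eq_piv ?(ltnW lt_u) //; [exact: fib | right].
  have [_ npiv _ _ _] := (stP j).2 nej.
  rewrite !alpha_subst_notin //; first by case: (eqt _ lt_t).
  by rewrite eq_piv ?(ltnW lt_t) //; right.
apply: digit_lt ltt; rewrite ?col_act ?sigmaK // => eqc; split.
  by rewrite alpha_subst // eq_piv //; [exact: fib | left].
by rewrite alpha_subst //; exact: fib.
Qed.

(* Marking each letter with the set of letters seen before it forces, in a
   subword embedding, every extra letter to be a copy of an earlier one. *)
Definition seen m (f : VIC_hom R n m) (t : 'I_m) :=
  [set letter f u | u : 'I_m & (u < t)%N].

Definition all_seen m (f : VIC_hom R n m) := [set letter f u | u : 'I_m].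

Definition marked_word m (f : VIC_hom R n m) := codom (fun t => (letter f t, seen f t)).

(** For the least [t] with [j < e t], the mark at [e t] gives a copy of the letter at some [u < t],
    and minimality puts [e u] before [j]. After the whole image, equality of [all_seen] replaces the
    mark. *)
Lemma marked_word_divides m p (f : VIC_hom R n m) (f' : VIC_hom R n p) :
    all_seen f = all_seen f' -> subseq (marked_word f) (marked_word f') ->
  divides (C := VIC_cat R) (fun m => @VIC_rank m) (existT _ m f) (existT _ p f').
Proof.
move=> eq_all /subseq_embedding[e e_mono e_word].
apply: (@embedding_divides _ _ _ _ e) => // [u|j nej]; first by have /(congr1 fst) := e_word u.
pose above t := (j < e t)%N.
case: (boolP [exists t, above t]) => [/existsP[t0 t0P]|/existsP noabove].
  have [t lt_jt min_t] := @arg_minnP _ t0 above val t0P.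
  have : letter f' j \in seen f' (e t) by apply/imsetP; exists j; rewrite ?inE //.
  have /(congr1 snd)/= -> := e_word t; case/imsetP=> u; rewrite inE => lt_ut eq_l.
  exists u => //; case: (ltngtP (e u) j) => // [lt_ju|/val_inj/esym/nej//].
  by have := min_t u lt_ju; rewrite leqNgt lt_ut.
have : letter f' j \in all_seen f by rewrite eq_all; apply: imset_f.
case/imsetP=> u _ eq_l; exists u => //.
case: (ltngtP (e u) j) => // [lt_ju|/val_inj/esym/nej//].
by case: noabove; exists u.
Qed.

End GroebnerVIC.

Lemma VIC_groebner (R : finPzRingType) : groebner (VIC_cat R).
Proof.
move=> n; exists (fun m => @VIC_rank R n m); first by move=> m; apply: VIC_rank_inj.
move=> z; have [phi phi_inc chain] := coloured_higman_chain
  (fun i => all_seen (projT2 (z i))) (fun i => marked_word (projT2 (z i))).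
exists phi => // i j /chain[]; case: (z (phi i)) (z (phi j)) => [m f] [p f'] /=.
exact: marked_word_divides.
Qed.

(** * Reduction to VIC *)

Lemma mem_List_In (T : eqType) (x : T) s : x \in s -> List.In x s.
Proof.
elim: s => //= y s IHs; rewrite inE => /orP[/eqP->|/IHs]; first by left.
by right.
Qed.

Lemma VI_hom_inj (R : finPzRingType) n m (f f' : VI_hom R n m) :
  sval f = sval f' -> f = f'.
Proof.
case: f f' => [A AP] [A' A'P] /= eqA; rewrite -eqA in A'P *.
by congr exist; apply: proof_irrelevance.
Qed.

(** Forgetting the left inverse is surjective on morphisms, so the identity suffices as list of
    factors. *)
Lemma VIC_VI_noetherian (R : finPzRingType) (k : pzRingType) :
  locally_noetherian (VIC_cat R) k -> locally_noetherian (VI_cat R) k.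
Proof.
apply: (@noetherian_transfer (VIC_cat R) (VI_cat R) k (fun n m f =>
  exist _ (sval f).1 (ex_intro _ (sval f).2 (svalP f)))).
- by move=> n; apply: VI_hom_inj.
- by move=> n m p g f; apply: VI_hom_inj.
move=> n; exists [:: existT _ n (idc (VI_cat R) n)] => m [A [B BA]].
exists (existT _ n (idc (VI_cat R) n)); first by left.
by exists (exist _ (A, B) BA); apply: VI_hom_inj; rewrite /= mulmx1.
Qed.

(* A matrix factors through the matrix of its distinct rows by a split injection. *)
Lemma VIC_V_noetherian (R : finPzRingType) (k : pzRingType) :
  locally_noetherian (VIC_cat R) k -> locally_noetherian (V_cat R) k.
Proof.
apply: (@noetherian_transfer (VIC_cat R) (V_cat R) k (fun n m f => (sval f).1)) => // n.
pose rows (X : {set 'rV[R]_n}) : {p : nat & 'M[R]_(p, n)} :=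
  existT _ #|X| (\matrix_(i < #|X|) enum_val i).
exists [seq rows X | X <- enum {set 'rV[R]_n}] => m A.
pose X := [set row i A | i : 'I_m].
exists (rows X).
  by apply/List.in_map_iff; exists X; split=> //; apply: mem_List_In; rewrite mem_enum.
have /fin_all_exists[r rP] i : exists u : 'I_#|X|, enum_val u = row i A.
  have Xi : row i A \in X by apply: imset_f.
  by exists (enum_rank_in Xi (row i A)); rewrite enum_rankK_in.
(* Choosing one occurrence of each distinct row gives a section [s] of [r], whence the left inverse
   of [rowsub r 1%:M]. *)
have /fin_all_exists[s sP] u : exists i, row i A = enum_val (u : 'I_#|X|).
  by have /imsetP[i _ ->] := enum_valP u; exists i.
have rsK : rowsub s 1%:M *m rowsub r 1%:M = 1%:M :> 'M[R]_#|X|.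
  rewrite mul_rowsub_mx mul1mx; apply/matrixP => u v; rewrite !mxE.
  by rewrite (_ : r (s u) = u) //; apply: enum_val_inj; rewrite rP sP.
exists (exist _ (rowsub r 1%:M, rowsub s 1%:M) rsK).
rewrite /= mul_rowsub_mx mul1mx; apply/row_matrixP => i.
by rewrite -rP; apply/rowP => j; rewrite !mxE.
Qed.

Theorem theoremA (R : finPzRingType) (k : pzRingType) (hk : left_noetherian k) :
  locally_noetherian (V_cat R) k /\ locally_noetherian (VI_cat R) k /\
  locally_noetherian (VIC_cat R) k.
Proof.
have VIC := groebner_noetherian hk (@VIC_groebner R).
by split; [exact: VIC_V_noetherian | split; [exact: VIC_VI_noetherian |]].
Qed.
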